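(* Let $\bar F(x,y,z)$ be a homogeneous form of degree $k$ over $\mathbb F_{q^3}$ and $\bar{\mathcal K}=V(\bar F)$ the corresponding variety of $\mathrm{PG}(2,q^3)$. Writing $x=x_0+\tau x_1+\tau^2x_2$, $y=y_0+\tau y_1+\tau^2y_2$, $z=z_0+\tau z_1+\tau^2z_2$ with $x_i,y_i,z_i\in\mathbb F_q$, expanding and simplifying yields \[\bar F(x,y,z)=G(x_0,x_1,x_2,y_0,y_1,y_2,z_0,z_1,z_2)=f_0+\tau f_1+\tau^2 f_2,\] where $f_0,f_1,f_2$ are homogeneous forms of degree $k$ over $\mathbb F_q$. In the Bose representation of $\mathrm{PG}(2,q^3)$: (1) in $\mathrm{PG}(8,q)$, the set of points lying on the planes of $[\mathcal K]=\{[\bar X]:\bar X\in\bar{\mathcal K}\}$ is the variety $V(f_0,f_1,f_2)$, denoted $\mathcal V([\mathcal K])$; (2) in $\mathrm{PG}(8,q^3)$, the variety-extension satisfies $\mathcal V([\mathcal K])^\star=V(G,G^q,G^{q^2})$, and its point set equals the set of points on the planes $\{\langle X,Y^q,Z^{q^2}\rangle : X,Y,Z\in\mathcal K\}$.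
   Context: $q$ is a prime power; $\tau$ is a primitive element of $\mathbb F_{q^3}$ with minimal polynomial $x^3-t_2x^2-t_1x-t_0$ over $\mathbb F_q$. Bose representation: for a point $\bar X=(x,y,z)$ of $\mathrm{PG}(2,q^3)$ and $\rho\in\mathbb F_{q^3}\setminus\{0\}$, write $\rho x=u_0+u_1\tau+u_2\tau^2$, $\rho y=v_0+v_1\tau+v_2\tau^2$, $\rho z=w_0+w_1\tau+w_2\tau^2$ ($u_i,v_i,w_i\in\mathbb F_q$) and take the point $(u_0,u_1,u_2,v_0,v_1,v_2,w_0,w_1,w_2)$ of $\mathrm{PG}(8,q)$; as $\rho$ varies these form a plane $[\bar X]$, and these planes form a regular $2$-spread of $\mathrm{PG}(8,q)$. $\mathrm{PG}(8,q)\subset\mathrm{PG}(8,q^3)$; for a point $X=(x_0,\dots,x_8)$, $X^q=(x_0^q,\dots,x_8^q)$. Set $\mathsf a_0=-\tau^q\tau^{q^2}$, $\mathsf a_1=\tau^q+\tau^{q^2}$, $\mathsf a_2=-1$, $A_0=(\mathsf a_0,\mathsf a_1,\mathsf a_2,0,\dots,0)$, $A_1=(0,0,0,\mathsf a_0,\mathsf a_1,\mathsf a_2,0,0,0)$, $A_2=(0,\dots,0,\mathsf a_0,\mathsf a_1,\mathsf a_2)$, $\Gamma=\langle A_0,A_1,A_2\rangle\subset\mathrm{PG}(8,q^3)$; the point $\bar X=(x,y,z)$ corresponds to $X=xA_0+yA_1+zA_2\in\Gamma$, and $\mathcal K=\{X:\bar X\in\bar{\mathcal K}\}\subset\Gamma$.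 $G^q=f_0+\tau^qf_1+\tau^{2q}f_2$ and $G^{q^2}=f_0+\tau^{q^2}f_1+\tau^{2q^2}f_2$. $V(g_1,\dots,g_m)$ is the set of points of the relevant projective space on which all $g_i$ vanish. The variety-extension $\mathcal V^\star$ of a variety $\mathcal V$ of $\mathrm{PG}(8,q)$ given by a set of equations over $\mathbb F_q$ is the set of points of $\mathrm{PG}(8,q^3)$ satisfying the same equations (here the equations $f_0=f_1=f_2=0$). *)

(* Defs.v *)
From HB Require Import structures.
From mathcomp Require Import all_boot all_order all_algebra all_field.
From mathcomp.multinomials Require Import mpoly.

Set Implicit Arguments.
Unset Strict Implicit.
Unset Printing Implicit Defensive.

Import GRing.Theory.
Local Open Scope ring_scope.

(* PG(n, K): the one-dimensional subspaces of K^(n+1); incidence of a point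
   with a subspace is inclusion of vector spaces. *)
Record point (K : fieldType) (n : nat) := Point {
  point_space :> {vspace 'rV[K]_n.+1};
  point_dim : \dim point_space == 1%N
}.

HB.instance Definition _ (K : fieldType) (n : nat) :=
  [isSub for @point_space K n].

Definition eval_at (K : fieldType) (n : nat) (g : {mpoly K[n.+1]})
    (v : 'rV[K]_n.+1) : K := g.@[fun m => v 0 m].

(* V(g_1, ..., g_m), a set of points.  All homogeneous coordinate vectors of P
   are tested; for homogeneous forms testing a single one is equivalent. *)
Definition variety (K : fieldType) (n : nat) (gs : seq {mpoly K[n.+1]})
    (P : point K n) : Prop :=
  forall v : 'rV[K]_n.+1, v \in (P : {vspace _}) -> v != 0 ->
  forall g, g \in gs -> eval_at g v = 0.

Section Bose.

Variables (F : finFieldType) (L : fieldExtType F).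
Implicit Types (q : nat) (tau : L).

(* Position of the i-th F-coordinate of the j-th L-coordinate: the nine
   coordinates are ordered x0 x1 x2 y0 y1 y2 z0 z1 z2. *)
Definition blk (j i : 'I_3) : 'I_9 := inord (3 * j + i).

(* The formal polynomial G(x0, ..., z2), obtained by substituting
   x0 + tau x1 + tau^2 x2 for x, and likewise for y and z.  As a polynomial
   over L it can also be evaluated at points of PG(8, q^3). *)
Definition bose_form tau (Fbar : {mpoly L[3]}) : {mpoly L[9]} :=
  Fbar \mPo [tuple \sum_(i < 3) tau ^+ i *: 'X_(blk j i) | j < 3].

Definition scalar_ext (f : {mpoly F[9]}) : {mpoly L[9]} :=
  map_mpoly (in_alg L) f.

(* With t = tau, tau^q, tau^(q^2) this is f0 + tau f1 + tau^2 f2, G^q and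
   G^(q^2) respectively. *)
Definition combine (t : L) (f0 f1 f2 : {mpoly F[9]}) : {mpoly L[9]} :=
  scalar_ext f0 + t *: scalar_ext f1 + t ^+ 2 *: scalar_ext f2.

Definition variety_extension (fs : seq {mpoly F[9]}) (P : point L 8) : Prop :=
  variety [seq scalar_ext f | f <- fs] P.

(* The plane [X] of PG(8, q), as the set of its points u, one for each
   multiplier rho. *)
Definition bose_plane tau (X : point L 2) (P : point F 8) : Prop :=
  exists (x : 'rV[L]_3) (rho : L) (u : 'rV[F]_9),
  [/\ X = <[x]>%VS :> {vspace _}, rho != 0,
      forall j : 'I_3, rho * x 0 j = \sum_(i < 3) u 0 (blk j i) *: tau ^+ i
    & P = <[u]>%VS :> {vspace _}].

Definition on_bose_planes tau (Kbar : point L 2 -> Prop) (P : point F 8) :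
    Prop :=
  exists2 X : point L 2, Kbar X & bose_plane tau X P.

Definition acoef q tau (i : 'I_3) : L :=
  [:: - (tau ^+ q * tau ^+ (q ^ 2)); tau ^+ q + tau ^+ (q ^ 2); -1]`_i.

Definition Avec q tau (j : 'I_3) : 'rV[L]_9 :=
  \sum_(i < 3) acoef q tau i *: delta_mx 0 (blk j i).

(* The set of points x A_0 + y A_1 + z A_2 of Gamma with (x, y, z) in Kbar. *)
Definition gamma_copy q tau (Kbar : point L 2 -> Prop) (P : point L 8) :
    Prop :=
  exists (X : point L 2) (x : 'rV[L]_3),
  [/\ Kbar X, X = <[x]>%VS :> {vspace _}
    & P = <[(\sum_(j < 3) x 0 j *: Avec q tau j)%R]>%VS :> {vspace _}].

(* The point (x_0^m, ..., x_8^m).  For m a power of q, v |-> v^m is semilinear,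
   so the choice of the coordinate vector is immaterial. *)
Definition conj_point (m : nat) (P : point L 8) : {vspace 'rV[L]_9} :=
  <[(map_mx (fun a => a ^+ m) (vpick P : 'rV[L]_9))%R]>%VS.

Definition on_conj_planes q (K : point L 8 -> Prop) (P : point L 8) : Prop :=
  exists X Y Z : point L 8,
  [/\ K X, K Y, K Z
    & (P <= (X : {vspace 'rV[L]_9}) + conj_point q Y + conj_point (q ^ 2) Z)%VS].

End Bose.

(* Main.v *)
(* Let phi_t send v to the three sums of t^i v_(j,i), so that G, G^q, G^(q^2)
   are f0 + t f1 + t^2 f2 for t = tau, tau^q, tau^(q^2) and G(v) = Fbar(phi_tau
   v).  These three conjugates are distinct, so a Vandermonde argument gives both
   V(f0, f1, f2) = V(G, G^q, G^(q^2)) and the independence of 1, tau, tau^2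
   over F.  Because the a_i are the coefficients of -(X - tau^q)(X - tau^(q^2)),
   phi_tau is a nonzero multiple of the coordinate map on Gamma and vanishes on
   Gamma^q and Gamma^(q^2); Lagrange interpolation then splits every vector of
   L^9 along Gamma + Gamma^q + Gamma^(q^2).  Applying inverse powers of
   Frobenius, G, G^q and G^(q^2) vanish at v iff Fbar vanishes at the coordinates
   of its three components.  A component may be zero, but not all three are, so
   K is nonempty and any point of K serves for a zero component. *)
From HB Require Import structures.
Require Import Defs.
From mathcomp Require Import all_boot all_order all_algebra all_solvable.
From mathcomp Require Import all_field ring.
From mathcomp.multinomials Require Import mpoly.

Set Implicit Arguments.
Unset Strict Implicit.
Unset Printing Implicit Defensive.

Import GRing.Theory.
Local Open Scope ring_scope.

(** * Projective points and zeros of homogeneous forms *)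

Section ProjectivePoints.

Variables (K : fieldType) (n : nat).

Lemma exists_point (v : 'rV[K]_n.+1) :
  v != 0 -> exists P : point K n, P = <[v]>%VS :> {vspace _}.
Proof.
move=> v_neq0; have dim_v : \dim <[v]> == 1%N by rewrite dim_vline v_neq0.
by exists (Point dim_v).
Qed.

Lemma point_vpick (P : point K n) :
  vpick P != 0 /\ P = <[vpick P]>%VS :> {vspace _}.
Proof.
have pick_neq0 : vpick P != 0.
  by rewrite vpick0 -dimv_eq0 (eqP (point_dim P)).
split=> //; apply/esym/eqP; rewrite eqEdim -memvE memv_pick /=.
by rewrite (eqP (point_dim P)) dim_vline pick_neq0.
Qed.

Lemma eval_at_homogZ k (g : {mpoly K[n.+1]}) a v :
  g \is k.-homog -> eval_at g (a *: v) = a ^+ k * eval_at g v.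
Proof.
move=> /dhomogP g_homog; rewrite /eval_at !mevalE big_distrr /=.
rewrite big_seq [RHS]big_seq; apply: eq_bigr => m /g_homog <-.
under eq_bigr do rewrite mxE exprMn.
by rewrite big_split /= prodrXr -mdegE mulrCA.
Qed.

(** All coordinate vectors of [P] are multiples of [v], and a form of degree [k] scales by [a ^+ k],
    so one vector decides. *)
Lemma variety_homogP k (g : {mpoly K[n.+1]}) (P : point K n) v :
  g \is k.-homog -> P = <[v]>%VS :> {vspace _} ->
  variety [:: g] P <-> eval_at g v = 0.
Proof.
move=> g_homog P_eq; have v_neq0 : v != 0.
  by have := eqP (point_dim P); rewrite P_eq dim_vline; case: eqP.
split=> [van|g_zero w]; first by apply: van; rewrite ?P_eq ?memv_line ?inE.
rewrite P_eq => /vlineP[a ->] _ h; rewrite inE => /eqP ->.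
by rewrite (eval_at_homogZ _ _ g_homog) g_zero mulr0.
Qed.

Lemma variety_seq3 (g0 g1 g2 : {mpoly K[n.+1]}) (P : point K n) :
  variety [:: g0; g1; g2] P <->
  forall v, v \in (P : {vspace _}) -> v != 0 ->
    [/\ eval_at g0 v = 0, eval_at g1 v = 0 & eval_at g2 v = 0].
Proof.
split=> van v vP v_neq0; last first.
  have [e0 e1 e2] := van v vP v_neq0.
  by move=> g; rewrite !inE => /or3P[] /eqP ->.
by split; apply: (van v vP v_neq0); rewrite !inE eqxx ?orbT.
Qed.

End ProjectivePoints.

(** Each monomial of degree [k] becomes a product of [k] linear forms. *)
Lemma comp_mpoly_homog (K : comNzRingType) n m k (p : {mpoly K[n]})
    (lq : n.-tuple {mpoly K[m]}) :
  (forall i, tnth lq i \is 1.-homog) -> p \is k.-homog ->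
  p \mPo lq \is k.-homog.
Proof.
move=> lq_homog /dhomogP p_homog; rewrite comp_mpolyEX big_seq.
apply: rpred_sum => mm /p_homog <-; apply: rpredZ.
rewrite comp_mpolyX /= mdegE.
elim/big_rec2: _ => [|i d p' _ IH]; first exact: dhomog1.
apply: dhomogM => //; rewrite -[X in X.-homog]mul1n; exact: dhomogMn.
Qed.

(** * Vandermonde and Lagrange identities at three distinct nodes *)

Section ThreeNodes.

Variables (K : fieldType) (t0 t1 t2 : K).
Hypotheses (t01 : t0 != t1) (t02 : t0 != t2) (t12 : t1 != t2).

Lemma quadratic_three_roots (p0 p1 p2 : K) :
  p0 + t0 * p1 + t0 ^+ 2 * p2 = 0 -> p0 + t1 * p1 + t1 ^+ 2 * p2 = 0 ->
  p0 + t2 * p1 + t2 ^+ 2 * p2 = 0 -> [/\ p0 = 0, p1 = 0 & p2 = 0].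
Proof.
move=> e0 e1 e2.
have p2_eq0 : p2 = 0.
  apply: (mulfI (_ : (t0 - t1) * (t0 - t2) * (t1 - t2) != 0)).
    by rewrite !mulf_neq0 ?subr_eq0.
  (* These weights cancel [p0] and [p1], leaving [p2] times the Vandermonde product. *)
  rewrite mulr0; transitivity
    ((t1 - t2) * (p0 + t0 * p1 + t0 ^+ 2 * p2)
     - (t0 - t2) * (p0 + t1 * p1 + t1 ^+ 2 * p2)
     + (t0 - t1) * (p0 + t2 * p1 + t2 ^+ 2 * p2)); first by ring.
  by rewrite e0 e1 e2; ring.
move: e0 e1; rewrite p2_eq0 !mulr0 !addr0 => e0 e1.
have p1_eq0 : p1 = 0.
  apply: (mulfI (_ : t0 - t1 != 0)); first by rewrite subr_eq0.
  by rewrite mulr0 -(subrr (0 : K)) -{1}e0 -e1; ring.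
by split=> //; move: e0; rewrite p1_eq0 mulr0 addr0.
Qed.

(** [a s t] lists the coefficients of -(X - s)(X - t), so after normalization the terms come from
    the Lagrange basis polynomials. The polynomial with coefficients [w] has degree at most 2, hence
    equals its interpolant, and the coefficients of X^i are compared. *)
Lemma lagrange_three_nodes (i : 'I_3) (w : 'I_3 -> K)
    (a := fun s t => [:: - (s * t); s + t; -1] : seq K) :
  (- ((t0 - t1) * (t0 - t2)))^-1 * ((\sum_(l < 3) t0 ^+ l * w l) * (a t1 t2)`_i)
  + (- ((t1 - t2) * (t1 - t0)))^-1
      * ((\sum_(l < 3) t1 ^+ l * w l) * (a t2 t0)`_i)
  + (- ((t2 - t0) * (t2 - t1)))^-1
      * ((\sum_(l < 3) t2 ^+ l * w l) * (a t0 t1)`_i)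
  = w i.
Proof.
have n01 : (t0 - t1 == 0) = false by rewrite subr_eq0 (negPf t01).
have n02 : (t0 - t2 == 0) = false by rewrite subr_eq0 (negPf t02).
have n12 : (t1 - t2 == 0) = false by rewrite subr_eq0 (negPf t12).
(* All differences get one orientation, so that the side conditions of [field] reduce to [n01],
   [n02] and [n12]. *)
rewrite -(opprB t0 t1) -(opprB t0 t2) -(opprB t1 t2) /a !big_ord_recl !big_ord0.
case: i => [[|[|[|//]]] lt_i3] /=.
- rewrite (_ : Ordinal _ = ord0); last exact/val_inj.
  by field; rewrite !(oppr_eq0, mulf_eq0, n01, n02, n12).
- rewrite (_ : Ordinal _ = lift ord0 ord0); last exact/val_inj.
  by rewrite /bump /=; field; rewrite !(oppr_eq0, mulf_eq0, n01, n02, n12).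
- rewrite (_ : Ordinal _ = lift ord0 (lift ord0 ord0)); last exact/val_inj.
  by rewrite /bump /=; field; rewrite !(oppr_eq0, mulf_eq0, n01, n02, n12).
Qed.

End ThreeNodes.

(** * Block indexing of the nine coordinates *)

Lemma val_blk j i : blk j i = (3 * j + i)%N :> nat.
Proof. by rewrite inordK //; case: j i => [[|[|[|?]]] ?] [[|[|[|?]]] ?]. Qed.

Lemma blk_inj j i j' i' : blk j i = blk j' i' -> j = j' /\ i = i'.
Proof.
move/(congr1 val); rewrite /= !val_blk ![(3 * _)%N]mulnC => eq_blk.
split; apply/val_inj => /=.
  by have := congr1 (divn^~ 3) eq_blk; rewrite !divnMDl ?divn_small ?addn0.
by have := congr1 (modn^~ 3) eq_blk; rewrite !modnMDl !modn_small.
Qed.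

Lemma blk_surj (m : 'I_9) : exists j i, m = blk j i.
Proof.
exists (inord (m %/ 3)), (inord (m %% 3)); apply/val_inj => /=.
rewrite val_blk !inordK ?ltn_mod //; last by rewrite ltn_divLR.
by rewrite mulnC -divn_eq.
Qed.

Lemma tnth_bose (F : finFieldType) (L : fieldExtType F) (tau : L) j :
  tnth [tuple \sum_(i < 3) tau ^+ i *: 'X_(blk j i) | j < 3] j =
  \sum_(i < 3) tau ^+ i *: 'X_(blk j i) :> {mpoly L[9]}.
Proof. by rewrite tnth_mktuple. Qed.

(** * The Frobenius map of L over F and evaluation at conjugate vectors *)

Section Frobenius.

Variables (F : finFieldType) (L : fieldExtType F).

Definition frob (x : L) : L := x ^+ #|F|.

(** The additive group of F is an elementary abelian p-group and L has the same characteristic p;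
    this makes the q-th power map additive on L. *)
Lemma pchar_nat_card : [pchar L].-nat #|F|.
Proof.
have [p _ pcharFp] := finPcharP F.
have : p.-nat #|F|.
  by rewrite -cardsT; apply: abelem_pgroup (fin_ring_pchar_abelem pcharFp).
by apply: sub_in_pnat => r _ /eqP ->; rewrite pchar_lalg.
Qed.

Fact frob_zmod_morphism : zmod_morphism frob.
Proof.
move=> x y; apply/eqP; rewrite eq_sym subr_eq /frob.
by rewrite -(exprDn_pchar _ _ pchar_nat_card) subrK.
Qed.

Fact frob_monoid_morphism : monoid_morphism frob.
Proof. by split=> [|x y]; rewrite /frob ?expr1n ?exprMn. Qed.

HB.instance Definition _ :=
  GRing.isZmodMorphism.Build L L frob frob_zmod_morphism.
HB.instance Definition _ :=
  GRing.isMonoidMorphism.Build L L frob frob_monoid_morphism.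

Lemma frob_alg (a : F) : frob a%:A = a%:A.
Proof. by rewrite /frob -(rmorphXn (in_alg L)) /= expf_card. Qed.

Lemma frobZ (a : F) x : frob (a *: x) = a *: frob x.
Proof. by rewrite -mulr_algl rmorphM /= frob_alg mulr_algl. Qed.

Lemma frob2E x : frob (frob x) = x ^+ (#|F| ^ 2).
Proof. by rewrite /frob -exprM mulnn. Qed.

Lemma eval_scalar_extE (f : {mpoly F[9]}) (v : 'rV[L]_9) :
  eval_at (scalar_ext L f) v =
  \sum_(m <- msupp f) (f@_m)%:A * \prod_i v 0 i ^+ m i.
Proof.
rewrite /eval_at /scalar_ext /map_mpoly [X in _.@[X]]/= raddf_sum /=.
by apply: eq_bigr => m _; rewrite mevalM mevalC mmap1_id mevalX.
Qed.

Lemma eval_scalar_ext_in_alg (f : {mpoly F[9]}) (u : 'rV[F]_9) :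
  eval_at (scalar_ext L f) (map_mx (in_alg L) u) = (eval_at f u)%:A.
Proof.
rewrite eval_scalar_extE /eval_at mevalE -[RHS]/(in_alg L _) rmorph_sum /=.
apply: eq_bigr => m _; rewrite -mulr_algl.
under eq_bigr do rewrite mxE -rmorphXn.
by rewrite -rmorph_prod /= !mulr_algl scalerA.
Qed.

Lemma frob_eval_scalar_ext (f : {mpoly F[9]}) (v : 'rV[L]_9) :
  eval_at (scalar_ext L f) (map_mx frob v) =
  frob (eval_at (scalar_ext L f) v).
Proof.
rewrite !eval_scalar_extE rmorph_sum; apply: eq_bigr => m _.
rewrite rmorphM rmorph_prod /= frob_alg; congr (_ * _).
by apply: eq_bigr => i _; rewrite mxE rmorphXn.
Qed.

Lemma mcoeff_combine t (f0 f1 f2 : {mpoly F[9]}) m :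
  (combine t f0 f1 f2)@_m =
  (f0@_m)%:A + t * (f1@_m)%:A + t ^+ 2 * (f2@_m)%:A :> L.
Proof.
have coefE f : (scalar_ext L f)@_m = (f@_m)%:A.
  exact: mcoeff_map_mpoly (in_alg L) m f.
rewrite -!coefE /combine.
(* What remains holds for any three polynomials over L, so the scalar extensions are generalized. *)
move: (scalar_ext L f0) (scalar_ext L f1) (scalar_ext L f2) => g0 g1 g2.
by rewrite 2!mcoeffD 2!mcoeffZ.
Qed.

Lemma eval_combine t (f0 f1 f2 : {mpoly F[9]}) (v : 'rV[L]_9) :
  eval_at (combine t f0 f1 f2) v =
  eval_at (scalar_ext L f0) v + t * eval_at (scalar_ext L f1) v
  + t ^+ 2 * eval_at (scalar_ext L f2) v.
Proof.
rewrite /combine.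
move: (scalar_ext L f0) (scalar_ext L f1) (scalar_ext L f2) => g0 g1 g2.
by rewrite /eval_at 2!mevalD 2!mevalZ.
Qed.

(** The coefficients of the [f_i] are fixed by [frob], so only [t] and [v] need conjugating. At
    [t = tau] this reads G^q(v^q) = G(v)^q. *)
Lemma frob_eval_combine t (f0 f1 f2 : {mpoly F[9]}) (v : 'rV[L]_9) :
  eval_at (combine (frob t) f0 f1 f2) (map_mx frob v) =
  frob (eval_at (combine t f0 f1 f2) v).
Proof.
apply: etrans (eval_combine _ _ _ _ _) _.
apply: etrans (congr1 frob (esym (eval_combine t f0 f1 f2 v))).
move: (frob_eval_scalar_ext f0 v) (frob_eval_scalar_ext f1 v)
  (frob_eval_scalar_ext f2 v).
move: (scalar_ext L f0) (scalar_ext L f1) (scalar_ext L f2).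
move=> g0 g1 g2 -> -> ->.
by rewrite !expr2 2!rmorphD !rmorphM.
Qed.

(* On Gamma, at [t = tau], this is up to a constant the inverse of the
   parametrization [expand] below. *)
Definition contract (t : L) (v : 'rV[L]_9) : 'rV[L]_3 :=
  \row_j \sum_(i < 3) t ^+ i * v 0 (blk j i).

Lemma contractD t v w : contract t (v + w) = contract t v + contract t w.
Proof.
apply/rowP => j; rewrite !mxE -big_split /=.
by apply: eq_bigr => i _; rewrite mxE mulrDr.
Qed.

Lemma contractZ t a v : contract t (a *: v) = a *: contract t v.
Proof.
apply/rowP => j; rewrite !mxE big_distrr /=.
by apply: eq_bigr => i _; rewrite mxE mulrCA.
Qed.

Lemma frob_contract t v :
  contract (frob t) (map_mx frob v) = map_mx frob (contract t v).
Proof.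
apply/rowP => j; rewrite !mxE rmorph_sum; apply: eq_bigr => i _.
by rewrite mxE rmorphM rmorphXn.
Qed.

Lemma eval_bose_form t (Fbar : {mpoly L[3]}) v :
  eval_at (bose_form t Fbar) v = eval_at Fbar (contract t v).
Proof.
rewrite /eval_at comp_mpoly_meval; apply: meval_eq => j.
rewrite tnth_bose mxE raddf_sum; apply: eq_bigr => i _ /=.
by rewrite mevalZ mevalXU.
Qed.

Lemma bose_form_homog t k (Fbar : {mpoly L[3]}) :
  Fbar \is k.-homog -> bose_form t Fbar \is k.-homog.
Proof.
apply: comp_mpoly_homog => j; rewrite tnth_bose; apply: rpred_sum => i _.
by apply: rpredZ; rewrite dhomogX /= mdeg1.
Qed.

(** The vector x A_0 + y A_1 + z A_2 of Gamma, written with the same sum as in [gamma_copy] so that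
    the two agree by conversion. *)
Definition expand q (tau : L) (x : 'rV[L]_3) : 'rV[L]_9 :=
  \sum_(j < 3) x 0 j *: Avec q tau j.

Lemma expandE q tau x j i : expand q tau x 0 (blk j i) = x 0 j * acoef q tau i.
Proof.
rewrite summxE (bigD1 j) //= big1 => [|j' j'j]; last first.
  rewrite mxE summxE big1 ?mulr0 // => i' _; rewrite !mxE eqxx /=.
  case: eqP => [/blk_inj[jj' _]|]; last by rewrite mulr0.
  by rewrite jj' eqxx in j'j.
rewrite addr0 mxE summxE (bigD1 i) //= big1 => [|i' i'i]; last first.
  rewrite !mxE eqxx /=; case: eqP => [/blk_inj[_ ii']|]; last by rewrite mulr0.
  by rewrite ii' eqxx in i'i.
by rewrite addr0 !mxE !eqxx mulr1.
Qed.

Lemma expandZ q tau a x : expand q tau (a *: x) = a *: expand q tau x.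
Proof.
by rewrite /expand scaler_sumr; apply: eq_bigr => j _; rewrite mxE scalerA.
Qed.

End Frobenius.

(** * The conjugates of [tau], and its powers as a basis of L over F *)

Section PrimitiveElement.

Variables (F : finFieldType) (L : fieldExtType F) (tau : L).
Hypothesis tau_prim : (#|F| ^ 3).-1.-primitive_root tau.

Notation q := #|F|.
Notation frob := (@frob F L).
Notation frobv := (map_mx frob).
Notation expand := (expand q tau).

Lemma frob3_prim : frob (frob (frob tau)) = tau.
Proof.
have q3_gt0 : (0 < q ^ 3)%N by rewrite expn_gt0 (ltnW (finNzRing_gt1 F)).
rewrite frob2E /frob -exprM -expnS -(prednK q3_gt0) exprS.
by rewrite (prim_expr_order tau_prim) mulr1.
Qed.

(** The order q^3 - 1 of [tau] exceeds q, so the exponents 1 and q are distinct modulo it. *)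
Lemma prim_neq_frob : tau != frob tau.
Proof.
have q_gt1 := finNzRing_gt1 F.
have lt_q : (q < (q ^ 3).-1)%N.
  rewrite -ltnS prednK ?expn_gt0 ?(ltnW q_gt1) //.
  (* Since q is at least 2, q + 2 <= 4 q <= q^3. *)
  have: (q * 4 <= q ^ 3)%N.
    by rewrite expnS leq_pmul2l ?(ltnW q_gt1) ?(leq_sqr 2).
  apply: leq_trans; apply: leq_trans (_ : q + 2 <= _)%N; first by rewrite addn2.
  by rewrite (mulnS _ 3) leq_add2l; apply: leq_trans q_gt1 _; rewrite leq_pmulr.
rewrite -[tau in X in X != _]expr1 (eq_prim_root_expr tau_prim).
by rewrite !modn_small ?(ltn_trans q_gt1) // neq_ltn q_gt1.
Qed.

Lemma frob_neq_frob2 : frob tau != frob (frob tau).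
Proof. by rewrite (inj_eq (fmorph_inj _)) prim_neq_frob. Qed.

Lemma prim_neq_frob2 : tau != frob (frob tau).
Proof.
rewrite -(inj_eq (fmorph_inj frob)) /= frob3_prim eq_sym; exact: prim_neq_frob.
Qed.

(** The value at [tau] of -(X - tau^q)(X - tau^(q^2)), by which [contract tau] scales the
    coordinates of a vector of Gamma. *)
Let conj_gap := - ((tau - frob tau) * (tau - frob (frob tau))).

Lemma conj_gap_neq0 : conj_gap != 0.
Proof.
by rewrite oppr_eq0 mulf_neq0 // subr_eq0 ?prim_neq_frob ?prim_neq_frob2.
Qed.

Lemma combine_conj_eq0 (f0 f1 f2 : {mpoly F[9]}) (v : 'rV[L]_9) :
  [/\ eval_at (combine tau f0 f1 f2) v = 0,
      eval_at (combine (frob tau) f0 f1 f2) v = 0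
    & eval_at (combine (frob (frob tau)) f0 f1 f2) v = 0] <->
  [/\ eval_at (scalar_ext L f0) v = 0, eval_at (scalar_ext L f1) v = 0
    & eval_at (scalar_ext L f2) v = 0].
Proof.
have := fun t => eval_combine t f0 f1 f2 v.
move: (scalar_ext L f0) (scalar_ext L f1) (scalar_ext L f2) => g0 g1 g2.
move: (eval_at g0 v) (eval_at g1 v) (eval_at g2 v) => p0 p1 p2 eval_eq.
rewrite !eval_eq.
split=> [[]|[-> -> ->]]; last by rewrite !mulr0 !addr0.
exact: (quadratic_three_roots prim_neq_frob prim_neq_frob2
  frob_neq_frob2).
Qed.

(** Conjugation fixes the coefficients, so a relation gives a quadratic with three distinct
    roots. *)
Lemma prim_powers_free (a0 a1 a2 : F) :
  a0%:A + tau * a1%:A + tau ^+ 2 * a2%:A = 0 ->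
  [/\ a0 = 0, a1 = 0 & a2 = 0].
Proof.
move=> e0; have e1 := congr1 frob e0; have e2 := congr1 frob e1.
move: e1 e2; rewrite !rmorph0 !rmorphD !rmorphM /= !frob_alg => e1 e2.
have [] := quadratic_three_roots prim_neq_frob prim_neq_frob2
  frob_neq_frob2 e0 e1 e2.
have alg_inj (a : F) : a%:A = 0 :> L -> a = 0.
  by move/eqP; rewrite -[_%:A]/(in_alg L a) fmorph_eq0 => /eqP.
by split; apply: alg_inj.
Qed.

Lemma prim_powers_indep (a : 'I_3 -> F) :
  \sum_(i < 3) a i *: tau ^+ i = 0 -> forall i, a i = 0.
Proof.
under eq_bigr do rewrite -mulr_algr; rewrite !big_ord_recl big_ord0 /bump /=.
rewrite expr0 mul1r expr1 addr0 addrA => /prim_powers_free[a0 a1 a2].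
case=> [[|[|[|//]]] lt_i3].
- by rewrite -[RHS]a0; congr a; apply/val_inj.
- by rewrite -[RHS]a1; congr a; apply/val_inj.
- by rewrite -[RHS]a2; congr a; apply/val_inj.
Qed.

Hypothesis dim_L : \dim {:L} = 3%N.

Let powers := [tuple tau ^+ i | i < 3].

Lemma prim_powers_basis : basis_of {:L} powers.
Proof.
rewrite basisEfree subvf size_tuple dim_L leqnn !andbT.
apply/freeP => a a_sum; apply: prim_powers_indep; rewrite -[RHS]a_sum.
by apply: eq_bigr => i _; rewrite (nth_mktuple _ _ i).
Qed.

(** [frob] is F-linear, so it is enough to check the basis of powers of [tau]. *)
Lemma frob3 x : frob (frob (frob x)) = x.
Proof.
rewrite (coord_basis prim_powers_basis (memvf x)) !rmorph_sum.
apply: eq_bigr => i _; rewrite /= !frobZ (nth_mktuple _ _ i).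
(* A bare [rmorphXn] would also unfold [frob tau] to the power [tau ^+ q]. *)
by rewrite !(fun y => rmorphXn frob i y : frob (y ^+ i) = frob y ^+ i)
  frob3_prim.
Qed.

Lemma frobv3 (v : 'rV[L]_9) : frobv (frobv (frobv v)) = v.
Proof. by apply/rowP => m; rewrite !mxE frob3. Qed.

(** * Splitting of L^9 along Gamma and its two conjugates *)

Lemma acoefE i :
  acoef q tau i =
  [:: - (frob tau * frob (frob tau)); frob tau + frob (frob tau); -1]`_i.
Proof. by rewrite frob2E. Qed.

(** Conjugation permutes [tau], tau^q, tau^(q^2) cyclically; the factors are ordered as in the
    second term of [lagrange_three_nodes]. *)
Lemma frob_acoef i :
  frob (acoef q tau i) =
  [:: - (frob (frob tau) * tau); frob (frob tau) + tau; -1]`_i.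
Proof.
rewrite acoefE; case: i => [[|[|[|//]]] lt_i3] /=.
- by rewrite rmorphN rmorphM /= frob3_prim.
- by rewrite rmorphD /= frob3_prim.
- by rewrite rmorphN rmorph1.
Qed.

Lemma frob2_acoef i :
  frob (frob (acoef q tau i)) = [:: - (tau * frob tau); tau + frob tau; -1]`_i.
Proof.
rewrite frob_acoef; case: i => [[|[|[|//]]] lt_i3] /=.
- by rewrite rmorphN rmorphM /= frob3_prim.
- by rewrite rmorphD /= frob3_prim.
- by rewrite rmorphN rmorph1.
Qed.

(** The sum of the a_i t^i is -(t - tau^q)(t - tau^(q^2)): it is [conj_gap] at [tau] and zero at the
    other two conjugates. *)
Lemma contract_expand t x :
  contract t (expand x) = - ((t - frob tau) * (t - frob (frob tau))) *: x.
Proof.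
apply/rowP => j; rewrite !mxE !big_ord_recl big_ord0 !expandE !acoefE /bump /=.
ring.
Qed.

Lemma contract_frob_expand x : contract tau (frobv (expand x)) = 0.
Proof.
(* With [tau] seen as the conjugate of tau^(q^2), Frobenius moves outside and leaves the node
   tau^(q^2), a root. *)
rewrite -[X in contract X _]frob3_prim frob_contract contract_expand.
by rewrite subrr mulr0 oppr0 scale0r map_mx0.
Qed.

Lemma contract_frob2_expand x : contract tau (frobv (frobv (expand x))) = 0.
Proof.
rewrite -[X in contract X _]frob3_prim !frob_contract contract_expand.
by rewrite subrr mul0r oppr0 scale0r !map_mx0.
Qed.

(** The projection onto Gamma along Gamma^q + Gamma^(q^2). *)
Definition gamma_part (w : 'rV[L]_9) := conj_gap^-1 *: expand (contract tau w).

(* [frob] has order 3 on L, so [frobv \o frobv] and [frobv] in the last two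
   arguments are the inverses of [frobv] and [frobv \o frobv]. *)
Lemma gamma_decomposition v :
  v = gamma_part v + frobv (gamma_part (frobv (frobv v)))
      + frobv (frobv (gamma_part (frobv v))).
Proof.
apply/rowP => m; have [j [i ->]] := blk_surj m.
(* Conjugating back the contraction of a conjugate of [v] evaluates [v] itself at the node tau^q, or
   tau^(q^2) in [contract2]. *)
have contract1 : frob (contract tau (frobv (frobv v)) 0 j)
    = contract (frob tau) v 0 j.
  by rewrite -[v in RHS]frobv3 frob_contract [RHS]mxE.
have contract2 : frob (frob (contract tau (frobv v) 0 j))
    = contract (frob (frob tau)) v 0 j.
  by rewrite -[v in RHS]frobv3 !frob_contract [RHS]mxE [in RHS]mxE.
have lagrange := lagrange_three_nodes prim_neq_frob prim_neq_frob2
  frob_neq_frob2 i (fun l => v 0 (blk j l)).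
apply: etrans (esym lagrange) _.
have gamma_partE w : gamma_part w 0 (blk j i)
    = conj_gap^-1 * (contract tau w 0 j * acoef q tau i).
  by rewrite mxE expandE.
have frobvE (w : 'rV[L]_9) n : frobv w 0 n = frob (w 0 n) by rewrite mxE.
rewrite [RHS]mxE [X in _ = X + _]mxE !frobvE !gamma_partE !rmorphM /=.
rewrite contract1 contract2.
rewrite frob2_acoef frob_acoef acoefE !fmorphV /conj_gap.
rewrite !rmorphN !rmorphM !rmorphB /= !frob3_prim !mxE.
by [].
Qed.


(** Each Frobenius twist of [v] brings exactly one summand into Gamma; [contract tau] kills the
    other two. *)
Lemma contract_conj_sum x y z
    (v := expand x + frobv (expand y) + frobv (frobv (expand z))) :
  [/\ contract tau v = conj_gap *: x, contract tau (frobv (frobv v)) = conj_gap *: y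
    & contract tau (frobv v) = conj_gap *: z].
Proof.
have frobvD (u w : 'rV[L]_9) : frobv (u + w) = frobv u + frobv w.
  exact: map_mxD.
by split; rewrite /v ?frobvD ?frobv3 !contractD contract_expand
  contract_frob_expand contract_frob2_expand ?addr0 ?add0r.
Qed.

Lemma contract_neq0 v :
  v != 0 -> [\/ contract tau v != 0, contract tau (frobv (frobv v)) != 0
    | contract tau (frobv v) != 0].
Proof.
move=> v_neq0.
have expand0 : expand 0 = 0 by rewrite -(scale0r 0) expandZ scale0r.
have [v0|] := eqVneq (contract tau v) 0; last by constructor 1.
have [v1|] := eqVneq (contract tau (frobv (frobv v))) 0; last by constructor 2.
have [v2|] := eqVneq (contract tau (frobv v)) 0; last by constructor 3.
case/eqP: v_neq0; rewrite [v]gamma_decomposition /gamma_part v0 v1 v2.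
by rewrite expand0 scaler0 !map_mx0 !addr0.
Qed.

(** * The components of G and the variety of PG(8, q) *)

Lemma bose_form_split (G : {mpoly L[9]}) :
  exists f0 f1 f2 : {mpoly F[9]}, G = combine tau f0 f1 f2.
Proof.
(* Each coefficient of [G] is replaced by its coordinates in the basis 1, tau, tau^2. *)
exists (map_mpoly (coord powers ord0) G),
  (map_mpoly (coord powers (lift ord0 ord0)) G),
  (map_mpoly (coord powers (lift ord0 (lift ord0 ord0))) G).
apply/mpolyP => m; rewrite mcoeff_combine.
have coefE i : (map_mpoly (coord powers i) G)@_m = coord powers i G@_m.
  exact: mcoeff_map_mpoly (coord powers i) m G.
rewrite (coefE ord0) 2!coefE.
rewrite {1}(coord_basis prim_powers_basis (memvf G@_m)).
rewrite !big_ord_recl big_ord0 -!tnth_nth !tnth_mktuple addr0.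
by rewrite expr0 expr1 !mulr_algr addrA.
Qed.

Section Form.

Variables (k : nat) (Fbar : {mpoly L[3]}) (f0 f1 f2 : {mpoly F[9]}).
Hypothesis Fbar_homog : Fbar \is k.-homog.
Hypothesis bose_eq : bose_form tau Fbar = combine tau f0 f1 f2.

(** A coefficient of G in a wrong degree is zero, hence so are its coordinates over 1, tau,
    tau^2. *)
Lemma components_homog :
  [/\ f0 \is k.-homog, f1 \is k.-homog & f2 \is k.-homog].
Proof.
have coef_eq0 m : mdeg m != k -> [/\ f0@_m = 0, f1@_m = 0 & f2@_m = 0].
  move=> deg_m.
  have := dhomog_nemf_coeff (bose_form_homog tau Fbar_homog) deg_m.
  by rewrite bose_eq mcoeff_combine; apply: prim_powers_free.
by split; apply/dhomogP => m; rewrite mcoeff_msupp;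
  apply: contra_neq_eq => /coef_eq0[].
Qed.

Lemma combine_conj_contract v :
  [/\ eval_at (combine tau f0 f1 f2) v = 0,
      eval_at (combine (frob tau) f0 f1 f2) v = 0
    & eval_at (combine (frob (frob tau)) f0 f1 f2) v = 0] <->
  [/\ eval_at Fbar (contract tau v) = 0,
      eval_at Fbar (contract tau (frobv (frobv v))) = 0
    & eval_at Fbar (contract tau (frobv v)) = 0].
Proof.
rewrite -!eval_bose_form bose_eq.
have frob_eq0 (x : L) : frob x = 0 <-> x = 0.
  by split=> [/eqP|->]; [rewrite fmorph_eq0 => /eqP | rewrite rmorph0].
(* The order 3 of Frobenius gives G^q(v) = G(v^(q^2))^q, and likewise G^(q^2)(v) = G(v^q)^(q^2)
   below. *)
have eq1 : eval_at (combine (frob tau) f0 f1 f2) v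
    = frob (eval_at (combine tau f0 f1 f2) (frobv (frobv v))).
  by have := frob_eval_combine tau f0 f1 f2 (frobv (frobv v)); rewrite frobv3.
have eq2 : eval_at (combine (frob (frob tau)) f0 f1 f2) v
    = frob (frob (eval_at (combine tau f0 f1 f2) (frobv v))).
  have <- := frob_eval_combine tau f0 f1 f2 (frobv v).
  have := frob_eval_combine (frob tau) f0 f1 f2 (frobv (frobv v)).
  by rewrite frobv3.
rewrite eq1 eq2; split=> [[-> /frob_eq0 -> /frob_eq0 /frob_eq0 ->] //|].
by case=> -> -> ->; rewrite !rmorph0.
Qed.

Lemma variety_extension_conj P :
  variety_extension [:: f0; f1; f2] P <->
  variety [:: combine tau f0 f1 f2; combine (frob tau) f0 f1 f2;
              combine (frob (frob tau)) f0 f1 f2] P.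
Proof.
rewrite /variety_extension !variety_seq3.
by split=> van v vP v_neq0; apply/combine_conj_eq0; apply: van.
Qed.

(** For [u] over F the [f_i] take values in F, so G(u) = 0 forces all three to vanish by
    independence of 1, tau, tau^2. *)
Lemma on_bose_planesP P :
  on_bose_planes tau (variety [:: Fbar]) P <-> variety [:: f0; f1; f2] P.
Proof.
have contract_alg (u : 'rV[F]_9) j : contract tau (map_mx (in_alg L) u) 0 j =
    \sum_(i < 3) u 0 (blk j i) *: tau ^+ i.
  by rewrite mxE; apply: eq_bigr => i _; rewrite mxE mulr_algr.
have eval_contract u : eval_at Fbar (contract tau (map_mx (in_alg L) u)) = 0 <->
    [/\ eval_at f0 u = 0, eval_at f1 u = 0 & eval_at f2 u = 0].
  rewrite -eval_bose_form bose_eq eval_combine.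
  move: (eval_scalar_ext_in_alg L f0 u) (eval_scalar_ext_in_alg L f1 u)
    (eval_scalar_ext_in_alg L f2 u).
  move: (scalar_ext L f0) (scalar_ext L f1) (scalar_ext L f2).
  move=> g0 g1 g2 -> -> ->.
  split=> [/prim_powers_free //|[-> -> ->]].
  by rewrite !scale0r !mulr0 !addr0.
split=> [[X KX [x [rho [u [X_eq rho_neq0 u_eq P_eq]]]]]|].
  apply/variety_seq3 => v; rewrite P_eq => /vlineP[a ->] _.
  apply/eval_contract.
  have -> : contract tau (map_mx (in_alg L) (a *: u)) = (a%:A * rho) *: x.
    rewrite map_mxZ contractZ -scalerA; congr (_ *: _).
    by apply/rowP => j; rewrite contract_alg -u_eq mxE.
  rewrite (eval_at_homogZ _ _ Fbar_homog).
  by move/(variety_homogP Fbar_homog X_eq): KX => ->; rewrite mulr0.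
move/variety_seq3 => van; have [u_neq0 P_eq] := point_vpick P.
set u := vpick P in u_neq0 P_eq.
pose x := contract tau (map_mx (in_alg L) u).
have x_neq0 : x != 0.
  apply: contra_neq u_neq0 => x0; apply/rowP => m.
  have [j [i ->]] := blk_surj m; rewrite [RHS]mxE.
  apply: (prim_powers_indep (a := fun i => u 0 (blk j i))).
  by rewrite -contract_alg -/x x0 mxE.
have [X X_eq] := exists_point x_neq0.
exists X.
  apply/(variety_homogP Fbar_homog X_eq)/eval_contract/van => //.
  exact: memv_pick.
(* The multiplier 1 suffices, since [x] is built from the coordinates [u]. *)
exists x, 1, u; split=> // [|j]; first exact: oner_neq0.
by rewrite mul1r contract_alg.
Qed.

(** * Planes spanned by conjugate points of the copy of K in Gamma *)

Notation K := (variety [:: Fbar]).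

Lemma gamma_copy_of_zero w :
  w != 0 -> eval_at Fbar w = 0 ->
  exists2 W : point L 8, gamma_copy q tau K W & expand w \in (W : {vspace _}).
Proof.
move=> w_neq0 w_zero; have [X X_eq] := exists_point w_neq0.
have expand_neq0 : expand w != 0.
  (* [expand] is injective: [contract tau] undoes it up to the nonzero factor [conj_gap]. *)
  apply: contra_neq w_neq0 => expand_w0.
  have := contract_expand tau w; rewrite expand_w0 -/conj_gap.
  rewrite -[X in contract _ X](scale0r 0) contractZ scale0r => /esym/eqP.
  by rewrite scaler_eq0 (negPf conj_gap_neq0) => /eqP.
have [W W_eq] := exists_point expand_neq0.
exists W; last by rewrite W_eq memv_line.
by exists X, w; split=> //; apply/(variety_homogP Fbar_homog X_eq).
Qed.

Lemma mem_gamma_copy (W : point L 8) u :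
  gamma_copy q tau K W -> u \in (W : {vspace _}) ->
  exists2 x, u = expand x & eval_at Fbar x = 0.
Proof.
case=> X [x [KX X_eq ->]] /vlineP[a ->]; exists (a *: x).
  by rewrite expandZ.
rewrite (eval_at_homogZ _ _ Fbar_homog).
by move/(variety_homogP Fbar_homog X_eq): KX => ->; rewrite mulr0.
Qed.

Lemma conj_pointE W :
  conj_point q W = <[frobv (vpick W)]>%VS /\
  conj_point (q ^ 2) W = <[frobv (frobv (vpick W))]>%VS.
Proof.
split=> //; congr <[_]>%VS; apply/rowP => m; rewrite !mxE frob2E //.
Qed.

Lemma mem_conj_point (W : point L 8) u :
  u \in (W : {vspace _}) ->
  frobv u \in conj_point q W /\ frobv (frobv u) \in conj_point (q ^ 2) W.
Proof.
have [-> ->] := conj_pointE W; have [_ {1}->] := point_vpick W.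
by case/vlineP => a ->; rewrite !map_mxZ !memvZ ?memv_line.
Qed.

Lemma on_conj_planesP P :
  variety_extension [:: f0; f1; f2] P <->
  on_conj_planes q (gamma_copy q tau K) P.
Proof.
rewrite variety_extension_conj variety_seq3; split=> [van|].
  have [v_neq0 P_eq] := point_vpick P; set v := vpick P in v_neq0 P_eq.
  have [] : [/\ eval_at Fbar (contract tau v) = 0,
      eval_at Fbar (contract tau (frobv (frobv v))) = 0
    & eval_at Fbar (contract tau (frobv v)) = 0].
    by apply/combine_conj_contract/van; rewrite ?memv_pick.
  move=> zero0 zero1 zero2.
  (* [W0] comes from a nonzero component of [v] and stands in for any component that is zero. *)
  have [W0 KW0] : exists W0, gamma_copy q tau K W0.
    by case: (contract_neq0 v_neq0) => /gamma_copy_of_zero[] // W0; exists W0.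
  have cover w : eval_at Fbar w = 0 ->
      exists2 W : point L 8,
        gamma_copy q tau K W & expand w \in (W : {vspace _}).
    have [-> _|] := eqVneq w 0; last exact: gamma_copy_of_zero.
    by exists W0; rewrite // -(scale0r 0) expandZ scale0r mem0v.
  have [X KX memX] := cover _ zero0; have [Y KY memY] := cover _ zero1.
  have [Z KZ memZ] := cover _ zero2.
  exists X, Y, Z; split=> //; rewrite P_eq -memvE [v]gamma_decomposition.
  apply: memv_add; first apply: memv_add; first exact: memvZ.
    exact: (mem_conj_point (memvZ _ memY)).1.
  exact: (mem_conj_point (memvZ _ memZ)).2.
case=> X [Y [Z [KX KY KZ /subvP sub]]] v /sub vXYZ _.
apply/combine_conj_contract; move: vXYZ.
have [_ [-> _]] := (conj_pointE X, conj_pointE Y); have [_ ->] := conj_pointE Z.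
case/memv_addP => _ /memv_addP[vX memX [_ /vlineP[b ->] ->]].
case=> _ /vlineP[d ->] ->.
have [x -> x_zero] := mem_gamma_copy KX memX.
have [y -> y_zero] := mem_gamma_copy KY (memv_pick _).
have [z -> z_zero] := mem_gamma_copy KZ (memv_pick _).
(* The scalars [b] and [d] pass inside Frobenius as their preimages, b^(q^2) and d^q. *)
have -> : b *: frobv (expand y) = frobv (expand (frob (frob b) *: y)).
  by rewrite expandZ map_mxZ /= frob3.
have -> : d *: frobv (frobv (expand z)) = frobv (frobv (expand (frob d *: z))).
  by rewrite expandZ !map_mxZ /= frob3.
have [-> -> ->] := contract_conj_sum x (frob (frob b) *: y) (frob d *: z).
by rewrite !(eval_at_homogZ _ _ Fbar_homog) x_zero y_zero z_zero !mulr0.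
Qed.

End Form.

End PrimitiveElement.

Theorem theorem5p6 (q : nat) (F : finFieldType) (L : fieldExtType F)
    (card_F : #|F| = q) (dim_L : \dim {:L} = 3%N)
    (tau : L) (tau_prim : (q ^ 3).-1.-primitive_root tau)
    (t0 t1 t2 : F)
    (tau_min : minPoly 1%VS tau =
      'X^3 - t2%:A *: 'X^2 - t1%:A *: 'X - (t0%:A)%:P)
    (k : nat) (Fbar : {mpoly L[3]}) (Fbar_homog : Fbar \is k.-homog) :
  (exists f0 f1 f2 : {mpoly F[9]},
     bose_form tau Fbar = combine tau f0 f1 f2) /\
  (forall f0 f1 f2 : {mpoly F[9]},
     bose_form tau Fbar = combine tau f0 f1 f2 ->
     [/\ [/\ f0 \is k.-homog, f1 \is k.-homog & f2 \is k.-homog],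
         (forall P : point F 8,
            on_bose_planes tau (variety [:: Fbar]) P <->
            variety [:: f0; f1; f2] P),
         (forall P : point L 8,
            variety_extension [:: f0; f1; f2] P <->
            variety [:: bose_form tau Fbar;
                        combine (tau ^+ q) f0 f1 f2;
                        combine (tau ^+ (q ^ 2)) f0 f1 f2] P)
       & (forall P : point L 8,
            variety_extension [:: f0; f1; f2] P <->
            on_conj_planes q (gamma_copy q tau (variety [:: Fbar])) P)]).

Proof.
subst q; split; first exact: (bose_form_split tau_prim dim_L).
move=> f0 f1 f2 bose_eq; split.
- exact: (components_homog tau_prim Fbar_homog bose_eq).
- exact: (on_bose_planesP tau_prim Fbar_homog bose_eq).
- by move=> P; rewrite bose_eq -frob2E; apply: variety_extension_conj.
- exact: (on_conj_planesP tau_prim dim_L Fbar_homog bose_eq).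
Qed.
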